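(* Let $(\mathfrak n,\langle\,,\,\rangle)$ be a 2-step nilpotent Lie algebra of corank $m$ endowed with an ad-invariant metric. Then $(\mathfrak n,\langle\,,\,\rangle)$ is isomorphic isometric to an orthogonal direct product of Lie algebras $\mathbb R^m\times \mathfrak n(\mathfrak v,\rho)$, where $\mathbb R^m$ is the abelian Lie algebra equipped with some metric and $\mathfrak n(\mathfrak v,\rho)$ is a modified cotangent of $\mathfrak v=C^1(\mathfrak n)^*$ (for some inner product $\langle\,,\,\rangle_{\mathfrak v}$ on $\mathfrak v$ and some injective linear map $\rho:\mathfrak v\to\mathfrak{so}(\mathfrak v)$ with $\rho(u)v+\rho(v)u=0$ for all $u,v\in\mathfrak v$).
   Context: All Lie algebras are real and finite dimensional. A metric on a real vector space is a non-degenerate symmetric bilinear form (of any signature); an inner product is a positive definite one. A metric on a Lie algebra $\mathfrak g$ is ad-invariant if $\langle [x,y],z\rangle+\langle y,[x,z]\rangle=0$ for all $x,y,z$. $C^1(\mathfrak g)=[\mathfrak g,\mathfrak g]$ is the commutator and $\mathfrak z$ the center. $\mathfrak n$ is 2-step nilpotent if $[\mathfrak n,[\mathfrak n,\mathfrak n]]=0$ and $[\mathfrak n,\mathfrak n]\ne 0$; its corank is $\dim\mathfrak z-\dim C^1(\mathfrak n)$. Two Lie algebras with metrics are isomorphic isometric if there is a Lie algebra isomorphism between them which is also an isometry. Modified cotangent: let $\mathfrak v$ be a real vector space with an inner product $\langle\,,\,\rangle_{\mathfrak v}$, let $\mathfrak{so}(\mathfrak v)$ be the skew-symmetric endomorphisms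 of $(\mathfrak v,\langle\,,\,\rangle_{\mathfrak v})$, and let $\rho:\mathfrak v\to\mathfrak{so}(\mathfrak v)$ be an injective linear map with $\rho(u)v+\rho(v)u=0$ for all $u,v\in\mathfrak v$. Then $\mathfrak n(\mathfrak v,\rho)=\mathfrak v^*\oplus\mathfrak v$ as a vector space, with the canonical hyperbolic metric $\langle z_1+v_1,z_2+v_2\rangle=z_1(v_2)+z_2(v_1)$ ($z_i\in\mathfrak v^*$, $v_i\in\mathfrak v$), and with Lie bracket given by $[\mathfrak v^*,\mathfrak n(\mathfrak v,\rho)]=0$, $[\mathfrak v,\mathfrak v]\subset\mathfrak v^*$ and $\langle[u,v],w\rangle=\langle\rho(w)u,v\rangle_{\mathfrak v}$ for $u,v,w\in\mathfrak v$. *)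

(* Defs.v *)
From HB Require Import structures.
From mathcomp Require Import all_boot all_order all_algebra.
From mathcomp Require Import reals.

Set Implicit Arguments.
Unset Strict Implicit.
Unset Printing Implicit Defensive.

Import Order.TTheory GRing.Theory Num.Theory.

Local Open Scope ring_scope.

HB.mixin Record Vector_isLieAlgebra (F : fieldType) L of Vector F L := {
  lie : L -> L -> L;
  lie_bilinear : bilinear_for *:%R *:%R lie;
  liexx : forall x, lie x x = 0;
  lie_jacobi : forall x y z,
    lie x (lie y z) + lie y (lie z x) + lie z (lie x y) = 0
}.

#[short(type="lieAlgType")]
HB.structure Definition LieAlgebra (F : fieldType) :=
  { L of Vector F L & Vector_isLieAlgebra F L }.

Section LieTheory.
Variables (F : fieldType) (L : lieAlgType F).
Implicit Types (x y z : L) (U V W : {vspace L}).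

HB.instance Definition _ :=
  bilinear_isBilinear.Build F L L L *:%R *:%R (@lie F L) (@lie_bilinear F L).

HB.instance Definition _ x := GRing.isLinear.Build F L L *:%R (@lie F L x)
  ((@lie_bilinear F L).2 x).

Lemma lieC x y : lie x y = - lie y x.
Proof.
apply/eqP; rewrite -addr_eq0; apply/eqP.
by have := liexx (x + y); rewrite linearDl /= !linearDr /= !liexx add0r addr0.
Qed.

Definition lie_prodv U V : {vspace L} :=
  <<[seq lie x y | x <- vbasis U, y <- vbasis V]>>%VS.

Lemma mem_lie_prodv U V x y : x \in U -> y \in V -> lie x y \in lie_prodv U V.
Proof.
move=> /coord_vbasis-> /coord_vbasis->.
rewrite linear_sumlz; apply: memv_suml => i _.
rewrite linear_sumr; apply: memv_suml => j _.
rewrite linearZl linearZr /= !memvZ // memv_span //.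
by apply/allpairsP; exists ((vbasis U)`_i, (vbasis V)`_j); rewrite !memt_nth.
Qed.

Lemma lie_prodvP U V W :
  reflect (forall x y, x \in U -> y \in V -> lie x y \in W)
          (lie_prodv U V <= W)%VS.
Proof.
apply: (iffP idP) => [sUVW x y Ux Vy | sUVW].
  by rewrite (subvP sUVW) // mem_lie_prodv.
apply/span_subvP => _ /allpairsP[[x y] /= [Ux Vy ->]].
by rewrite sUVW ?vbasis_mem.
Qed.

Definition commutator : {vspace L} := lie_prodv fullv fullv.

Definition ad x : 'End(L) := linfun (lie x).

Lemma ad_is_linear : linear ad.
Proof.
move=> a x y; apply/lfunP => z.
rewrite add_lfunE scale_lfunE /ad !lfunE /=.
exact: (lie_bilinear.1 z a x y).
Qed.

HB.instance Definition _ := GRing.isLinear.Build F L 'End(L) _ ad ad_is_linear.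

Definition center : {vspace L} := lker (linfun ad).

Lemma centerP x : reflect (forall y, lie x y = 0) (x \in center).
Proof.
rewrite memv_ker lfunE /=; apply: (iffP eqP) => [x0 y | x0].
  by rewrite -[LHS](lfunE (lie x)) -/(ad x) x0 lfunE.
by apply/lfunP => y; rewrite !lfunE /= x0.
Qed.

Definition two_step_nilpotent : Prop :=
  lie_prodv fullv commutator = 0%VS /\ commutator <> 0%VS.

(* The subtraction is truncated only when [dim center < dim commutator], which
   never happens for a 2-step nilpotent Lie algebra (see [commutator_center]). *)
Definition corank : nat := (\dim center - \dim commutator)%N.

Lemma commutator_center : two_step_nilpotent -> (commutator <= center)%VS.
Proof.
case=> nil _; apply/subvP => x Cx; apply/centerP => y.
have : lie y x \in lie_prodv fullv commutator by rewrite mem_lie_prodv ?memvf.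
by rewrite nil memv0 => /eqP yx0; rewrite lieC yx0 oppr0.
Qed.

Definition ad_invariant (g : {symmetric L}) : Prop :=
  forall x y z, g (lie x y) z + g y (lie x z) = 0.

End LieTheory.

Definition isomorphic_isometric (F : fieldType) (L1 L2 : lieAlgType F)
    (g1 : {symmetric L1}) (g2 : {symmetric L2}) : Prop :=
  exists f : {linear L1 -> L2},
    [/\ bijective f, {morph f : x y / lie x y >-> lie x y}
      & isometry g2 g1 f].

Section OrthogonalProduct.
Variables (F : fieldType) (L1 L2 : lieAlgType F).

Definition prod_lie (x y : L1 * L2) : L1 * L2 := (lie x.1 y.1, lie x.2 y.2).

Lemma prod_lie_bilinear : bilinear_for *:%R *:%R prod_lie.
Proof.
by split=> [y a x x' | x a y y']; congr (_, _); rewrite /= (linearPl, linearPr).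
Qed.

Lemma prod_liexx x : prod_lie x x = 0.
Proof. by rewrite /prod_lie !liexx. Qed.

Lemma prod_lie_jacobi x y z : prod_lie x (prod_lie y z)
  + prod_lie y (prod_lie z x) + prod_lie z (prod_lie x y) = 0.
Proof. by congr (_, _); apply: lie_jacobi. Qed.

HB.instance Definition _ := Vector_isLieAlgebra.Build F (L1 * L2)%type
  prod_lie_bilinear prod_liexx prod_lie_jacobi.

Variables (g1 : {symmetric L1}) (g2 : {symmetric L2}).

Definition prod_metric (x y : L1 * L2) : F := g1 x.1 y.1 + g2 x.2 y.2.

Lemma prod_metric_bilinear : bilinear_for *%R (idfun \; *%R) prod_metric.
Proof.
split=> [y a x x' | x a y y']; rewrite /prod_metric /=.
  by rewrite !linearPl /= mulrDr addrACA.
by rewrite !linearPr /= mulrDr addrACA.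
Qed.

Lemma prod_metric_sym x y :
  prod_metric x y = (-1) ^+ false * idfun (prod_metric y x).
Proof.
rewrite /prod_metric (hermitian_subproof x.1) (hermitian_subproof x.2) /=.
by rewrite !mul1r.
Qed.

HB.instance Definition _ := bilinear_isBilinear.Build F _ _ _ _ _
  prod_metric prod_metric_bilinear.
HB.instance Definition _ := isHermitianSesquilinear.Build F _ _ _
  prod_metric prod_metric_sym.

End OrthogonalProduct.

(* An alias, so that ['rV[F]_m] itself carries no canonical bracket. *)
Definition abelian_lie (F : fieldType) (m : nat) : Type := 'rV[F]_m.

Section AbelianLie.
Variables (F : fieldType) (m : nat).

HB.instance Definition _ := Vector.copy (abelian_lie F m) 'rV[F]_m.

Definition abelian_bracket (x y : abelian_lie F m) : abelian_lie F m := 0.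

Lemma abelian_bracket_bilinear : bilinear_for *:%R *:%R abelian_bracket.
Proof. by split=> ? a ? ?; rewrite /abelian_bracket /= scaler0 addr0. Qed.

Lemma abelian_bracketxx x : abelian_bracket x x = 0.
Proof. by []. Qed.

Lemma abelian_bracket_jacobi x y z :
  abelian_bracket x (abelian_bracket y z)
  + abelian_bracket y (abelian_bracket z x)
  + abelian_bracket z (abelian_bracket x y) = 0.
Proof. by rewrite /abelian_bracket !addr0. Qed.

HB.instance Definition _ := Vector_isLieAlgebra.Build F (abelian_lie F m)
  abelian_bracket_bilinear abelian_bracketxx abelian_bracket_jacobi.

End AbelianLie.

Definition dual (F : fieldType) (V : vectType F) : vectType F := 'Hom(V, F^o).

Section ModifiedCotangent.
Variables (R : realFieldType) (V : vectType R) (ip : {dot V for idfun}).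

Definition is_so (f : 'End(V)) : Prop :=
  forall u v, ip (f u) v + ip u (f v) = 0.

Record so_map := SoMap {
  so_map_fun :> 'Hom(V, 'End(V));
  so_map_so : forall u, is_so (so_map_fun u);
  so_map_inj : injective so_map_fun;
  so_map_alt : forall u v, so_map_fun u v + so_map_fun v u = 0
}.

Variable rho : so_map.

Definition modified_cotangent of so_map : Type := (dual V * V)%type.

HB.instance Definition _ (r : so_map) :=
  Vector.copy (modified_cotangent r) (dual V * V)%type.

Local Notation n := (modified_cotangent rho).
Implicit Types x y z : n.

Definition mcot_pairing (u v : V) (w : V) : R^o := ip (rho w u) v.

Lemma mcot_pairing_is_linear u v : linear (mcot_pairing u v).
Proof.
move=> a w w'; rewrite /mcot_pairing linearP /= add_lfunE scale_lfunE.
by rewrite linearPl.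
Qed.

HB.instance Definition _ u v := GRing.isLinear.Build R V R^o _
  (mcot_pairing u v) (mcot_pairing_is_linear u v).

Definition mcot_bracket x y : n := (linfun (mcot_pairing x.2 y.2), 0).

Lemma mcot_bracket_bilinear : bilinear_for *:%R *:%R mcot_bracket.
Proof.
split=> [y a x x' | x a y y']; congr (_, _); rewrite /= ?scaler0 ?addr0 //;
  apply/lfunP => w; rewrite !lfunE /= !lfunE /= lfunE /mcot_pairing /=.
  by rewrite linearP linearPl.
by rewrite linearPr.
Qed.

Lemma mcot_bracketxx x : mcot_bracket x x = 0.
Proof.
congr (_, _); apply/lfunP => w; rewrite !lfunE /= /mcot_pairing.
have := so_map_so rho w x.2 x.2.
rewrite (hermitian_subproof x.2) /= mul1r => /eqP.
by rewrite -mulr2n mulrn_eq0 /= => /eqP.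
Qed.

Lemma mcot_bracket0 x y z : mcot_bracket x (mcot_bracket y z) = 0.
Proof.
by congr (_, _); apply/lfunP => w; rewrite !lfunE /= /mcot_pairing linear0r.
Qed.

Lemma mcot_bracket_jacobi x y z : mcot_bracket x (mcot_bracket y z)
  + mcot_bracket y (mcot_bracket z x) + mcot_bracket z (mcot_bracket x y) = 0.
Proof. by rewrite !mcot_bracket0 !addr0. Qed.

HB.instance Definition _ := Vector_isLieAlgebra.Build R n
  mcot_bracket_bilinear mcot_bracketxx mcot_bracket_jacobi.

Definition mcot_metric x y : R := x.1 y.2 + y.1 x.2.

Lemma mcot_metric_bilinear : bilinear_for *%R (idfun \; *%R) mcot_metric.
Proof.
split=> [y a x x' | x a y y']; rewrite /mcot_metric /=;
  by rewrite linearP add_lfunE scale_lfunE mulrDr addrACA.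
Qed.

Lemma mcot_metric_sym x y :
  mcot_metric x y = (-1) ^+ false * idfun (mcot_metric y x).
Proof. by rewrite mul1r /mcot_metric addrC. Qed.

HB.instance Definition _ := bilinear_isBilinear.Build R n n R _ _
  mcot_metric mcot_metric_bilinear.
HB.instance Definition _ := isHermitianSesquilinear.Build R n _ _
  mcot_metric mcot_metric_sym.

(* The defining relation <[u, v], w> = <rho(w) u, v>_V, with u, v, w : V embedded
   in the second factor. *)
Lemma mcot_metricE (u v w : V) :
  mcot_metric (lie ((0, u) : n) ((0, v) : n)) (0, w) = ip (rho w u) v.
Proof. by rewrite /mcot_metric /= !lfunE /= addr0. Qed.

End ModifiedCotangent.

Arguments mcot_metric {R V ip} rho x y.

(* Main.v *)
(* Ad-invariance makes the centre [z] the orthogonal of [C = C^1(n)], so [C] is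
   totally isotropic and [x |-> g(x, .)|C] maps [n] onto [C^*] with kernel [z].
   Nondegeneracy gives this map a section [s] with totally isotropic image.  The
   component of [x] in [C^*] is then [p x = g(x, .)|C], the one in [C^**] is
   [g(x, s _)], and the one in [R^m] is the class of the central element
   [x - s (p x)] in [z/C], on which [g] descends.  These components form an
   isometry, hence an injection, hence a bijection by dimension count.  Any inner
   product on [C^*] will do: [rho] is read off the alternating trilinear form
   [g([s u, s v], s w)]. *)
From HB Require Import structures.
Require Import Defs.
From mathcomp Require Import all_boot all_order all_algebra.
From mathcomp Require Import reals.
From mathcomp Require Import ring.

Set Implicit Arguments.
Unset Strict Implicit.
Unset Printing Implicit Defensive.

Import Order.TTheory GRing.Theory Num.Theory.

Local Open Scope ring_scope.

(** * Linear maps and coordinates *)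

Section VectorFacts.
Variables (F : fieldType) (U V : vectType F).

(** Packing [f] with its linearity proof on the spot makes [lfunE] available for locally defined
    functions without a canonical linear structure. *)
Lemma linear_lfunE (f : U -> V) : linear f -> linfun f =1 f.
Proof.
move=> f_lin; pose m := GRing.isLinear.Build F U V *:%R f f_lin.
pose h : {linear U -> V} := HB.pack f m.
exact: (lfunE h).
Qed.

Lemma inj_lfun_bij (f : 'Hom(U, V)) :
  injective f -> \dim {:U} = \dim {:V} -> bijective f.
Proof.
move=> f_inj dimUV; have kf : lker f == 0%VS by apply/lker0P.
exists (f^-1)%VF; first exact: lker0_lfunK.
move=> v; apply: limg_lfunVK; suff -> : limg f = fullv by rewrite memvf.
by apply/eqP; rewrite eqEdim subvf -dimUV limg_dim_eq ?(eqP kf) ?capv0 /=.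
Qed.

End VectorFacts.

Lemma vspace_coordinates (F : fieldType) (V : vectType F) m (W : {vspace V}) : \dim W = m ->
  exists (a : 'Hom('rV[F]_m, V)) (b : 'Hom(V, 'rV[F]_m)),
    {in W, cancel b a}.
Proof.
move=> <-; pose e := vbasis W.
pose a (r : 'rV[F]_(\dim W)) := \sum_i r 0 i *: e`_i.
pose b v : 'rV[F]_(\dim W) := \row_i coord e i v.
have a_lin : linear a.
  move=> k r r'; rewrite /a scaler_sumr -big_split; apply: eq_bigr => i _ /=.
  by rewrite !mxE scalerDl scalerA.
have b_lin : linear b by move=> k v v'; apply/rowP => i; rewrite !mxE linearP.
exists (linfun a), (linfun b) => v Wv.
rewrite (linear_lfunE b_lin) (linear_lfunE a_lin) [RHS](coord_vbasis Wv).
by apply: eq_bigr => i _; rewrite mxE.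
Qed.

(** * Symmetric forms, nondegeneracy and pullback *)

Section SymmetricForms.
Variables (F : fieldType) (V : vectType F) (g : {symmetric V}).

Lemma symmetric_formC x y : g x y = g y x.
Proof. by rewrite (hermitian_subproof x) /= mul1r. Qed.

Lemma nondegenerateP :
  reflect (forall x, (forall y, g x y = 0) -> x = 0) (nondegenerate g).
Proof.
apply: (iffP eqP) => [rad0 x x0 | g0].
  by apply/eqP; rewrite -memv0 -rad0; apply/mem_orthovP => y _.
apply/eqP; rewrite -subv0; apply/subvP => x /mem_orthovP x0.
by rewrite memv0; apply/eqP/g0 => y; apply: x0; rewrite memvf.
Qed.

Lemma form_linear x : linear (g x : V -> F^o).
Proof. by move=> a y z; rewrite linearPr. Qed.

(** Nondegeneracy makes [x |-> g x _] an injection into the dual, and equal dimensions make it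
    onto. *)
Lemma nondegenerate_riesz (f : dual V) : nondegenerate g ->
  exists x, forall y, g x y = f y.
Proof.
move=> /nondegenerateP g0.
pose flat x : dual V := linfun (g x : V -> F^o).
have flatE x y : flat x y = g x y by rewrite linear_lfunE //; apply: form_linear.
have flat_lin : linear flat.
  move=> a x y; apply/lfunP => z.
  by rewrite add_lfunE scale_lfunE !flatE linearPl.
have flat_inj : injective (linfun flat).
  apply/lker0P; rewrite -subv0; apply/subvP => x.
  rewrite memv_ker memv0 linear_lfunE // => /eqP x0.
  by apply/eqP/g0 => y; rewrite -flatE x0 lfunE.
have [|h _ hK] := inj_lfun_bij flat_inj.
  by rewrite !dimvf /dim /= muln1.
by exists (h f) => y; rewrite -flatE -(linear_lfunE flat_lin) hK.
Qed.

End SymmetricForms.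

Section Pullback.
Variables (F : fieldType) (U V : vectType F) (g : {symmetric V}).
Variable a : 'Hom(U, V).

Definition pullback_form x y := g (a x) (a y).

Lemma pullback_form_bilinear : bilinear_for *%R (idfun \; *%R) pullback_form.
Proof.
by split=> [y k x x' | x k y y']; rewrite /pullback_form linearP (linearPl, linearPr).
Qed.

Lemma pullback_form_sym x y :
  pullback_form x y = (-1) ^+ false * idfun (pullback_form y x).
Proof. by rewrite mul1r /pullback_form symmetric_formC. Qed.

HB.instance Definition _ := bilinear_isBilinear.Build F U U F _ _
  pullback_form pullback_form_bilinear.
HB.instance Definition _ := isHermitianSesquilinear.Build F U _ _
  pullback_form pullback_form_sym.

End Pullback.

(** * Inner products, and skew endomorphisms from alternating forms *)

Section CoordDot.
Variables (R : realFieldType) (V : vectType R).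

(** The inner product for which the chosen basis is orthonormal. *)
Definition coord_dot (x y : V) : R :=
  \sum_i coord (vbasis {:V}) i x * coord (vbasis {:V}) i y.

Lemma coord_dot_bilinear : bilinear_for *%R (idfun \; *%R) coord_dot.
Proof.
split=> [y k x x' | x k y y']; rewrite /coord_dot /= mulr_sumr -big_split;
  apply: eq_bigr => i _; rewrite linearP /=; ring.
Qed.

Lemma coord_dot_sym x y :
  coord_dot x y = (-1) ^+ false * idfun (coord_dot y x).
Proof. by rewrite mul1r; apply: eq_bigr => i _; rewrite mulrC. Qed.

Lemma coord_dot_gt0 x : x != 0 -> 0 < coord_dot x x.
Proof.
move=> x0; have sq_ge0 i : 0 <= coord (vbasis {:V}) i x * coord (vbasis {:V}) i x.
  by rewrite -expr2 sqr_ge0.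
rewrite lt_def sumr_ge0 // andbT; apply: contraNneq x0 => /psumr_eq0P x0.
rewrite (coord_vbasis (memvf x)) big1 // => i _.
have /eqP := x0 (fun i _ => sq_ge0 i) i isT.
by rewrite mulf_eq0 orbb => /eqP->; rewrite scale0r.
Qed.

HB.instance Definition _ := bilinear_isBilinear.Build R V V R _ _
  coord_dot coord_dot_bilinear.
HB.instance Definition _ := isHermitianSesquilinear.Build R V _ _
  coord_dot coord_dot_sym.
HB.instance Definition _ := isDotProduct.Build R V coord_dot coord_dot_gt0.

End CoordDot.

Lemma dot_nondegenerate (R : realFieldType) (V : vectType R)
  (ip : {dot V for idfun}) : nondegenerate ip.
Proof.
apply/nondegenerateP => x x0; apply: contraTeq isT => /(neq0_dnorm_gt0 (s:=ip)).
by rewrite x0 ltxx.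
Qed.

(** Riesz represents [v |-> T u v w] by a vector [rho w u]. Antisymmetry in slots 1 and 2 makes
    [rho w] skew, antisymmetry in slots 1 and 3 gives [rho u v + rho v u = 0], and the last
    hypothesis gives injectivity. *)
Lemma so_map_of_alternating (R : realFieldType) (V : vectType R)
    (ip : {dot V for idfun}) (T : V -> V -> V -> R) :
    (forall v w, linear (fun u => T u v w : R^o)) ->
    (forall u v w, T u v w = - T v u w) ->
    (forall u v w, T u v w = - T w v u) ->
    (forall w, (forall u v, T u v w = 0) -> w = 0) ->
  exists rho : so_map ip, forall u v w, ip (rho w u) v = T u v w.
Proof.
move=> T1 T12 T13 T0.
have T2 u w : linear (fun v => T u v w : R^o).
  by move=> a x y; rewrite !(T12 u) T1 opprD scalerN.
have T3 u v : linear (fun w => T u v w : R^o).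
  by move=> a x y; rewrite !(T13 u) T1 opprD scalerN.
have ipI x y : (forall v, ip x v = ip y v) -> x = y.
  move=> xy; apply/eqP; rewrite -subr_eq0; apply/eqP.
  by apply: (nondegenerateP _ (dot_nondegenerate ip)) => v; rewrite linearBl /= xy subrr.
(* The boolean equality of functionals lets [xchoose] select the Riesz vector; linearity of the
   choice then follows from uniqueness, [ipI]. *)
have op_ex w u : exists x, linfun (ip x : V -> R^o) == linfun (fun v => T u v w : R^o).
  have [x xE] := nondegenerate_riesz (linfun (fun v => T u v w : R^o))
    (dot_nondegenerate ip).
  exists x; apply/eqP/lfunP => v; rewrite -xE linear_lfunE //.
  exact: form_linear.
pose op w u := xchoose (op_ex w u).
have opE w u v : ip (op w u) v = T u v w.
  have /eqP/lfunP/(_ v) := xchooseP (op_ex w u).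
  by rewrite !linear_lfunE //; apply: form_linear.
have op_lin w : linear (op w).
  move=> a u u'; apply: ipI => v; rewrite linearPl /= !opE; exact: T1.
have rho_lin : linear (fun w => linfun (op w)).
  move=> a w w'; apply/lfunP => u; rewrite add_lfunE scale_lfunE !linear_lfunE //.
  by apply: ipI => v; rewrite linearPl /= !opE; apply: T3.
pose rho := linfun (fun w => linfun (op w)).
have rhoE u v w : ip (rho w u) v = T u v w by rewrite !linear_lfunE.
have ipC x y : ip x y = ip y x by apply: symmetric_formC.
have rho_so w : is_so ip (rho w).
  move=> u v; rewrite rhoE ipC rhoE; apply/eqP.
  by rewrite addr_eq0 {1}T12.
have rho_inj : injective rho.
  apply/lker0P; rewrite -subv0; apply/subvP => w; rewrite memv_ker memv0 => /eqP w0.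
  by apply/eqP/T0 => u v; rewrite -rhoE w0 lfunE linear0l.
have rho_alt u v : rho u v + rho v u = 0.
  by apply: ipI => x; rewrite linearDl /= !rhoE linear0l (T13 v) addNr.
by exists (SoMap rho_so rho_inj rho_alt).
Qed.

(** * Isotropic splittings *)

Section IsotropicSection.
Variables (R : realFieldType) (U V : vectType R) (g : {symmetric V}).

(** Riesz vectors of a dual basis give a first section [t]; a correction inside the image of [i]
    then makes it isotropic. *)
Lemma isotropic_section (i : 'Hom(U, V)) :
    nondegenerate g -> injective i -> (forall u u', g (i u) (i u') = 0) ->
  exists s : 'Hom(dual U, V),
    (forall f u, g (s f) (i u) = f u) /\ (forall f f', g (s f) (s f') = 0).
Proof.
move=> g_nd i_inj i_iso; pose e := vbasis {:U}.
have iK : cancel i i^-1%VF by apply/lker0_lfunK/lker0P.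
(* The functional is prescribed on the image of [i] only; [i^-1], defined on all of [V], extends it
   so that Riesz applies. *)
have w_ex j : exists w, forall u, g w (i u) = coord e j u.
  have [w wE] := nondegenerate_riesz
    (linfun (coord e j : U -> R^o) \o i^-1)%VF g_nd.
  by exists w => u; rewrite wE comp_lfunE /= iK lfunE.
have [w wE] := fin_all_exists w_ex.
pose t (f : dual U) := \sum_(j < \dim {:U}) f e`_j *: w j.
have t_lin : linear t.
  move=> a f f'; rewrite /t scaler_sumr -big_split; apply: eq_bigr => j _ /=.
  by rewrite add_lfunE scale_lfunE scalerDl scalerA.
have tE f u : g (t f) (i u) = f u.
  rewrite linear_sumlz [in RHS](coord_vbasis (memvf u)) linear_sum.
  by apply: eq_bigr => j _; rewrite linearZl /= wE linearZ /= mulrC.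
(* [k f] is the vector in the image of [i] that pairs with every [t f'] as [t f] does. *)
pose k (f : dual U) := \sum_(j < \dim {:U}) g (w j) (t f) *: i e`_j.
have k_lin : linear k.
  move=> a f f'; rewrite /k scaler_sumr -big_split; apply: eq_bigr => j _ /=.
  by rewrite t_lin linearPr scalerDl scalerA.
have kE f f' : g (t f) (k f') = g (t f) (t f').
  rewrite linear_sumr {2}/t linear_sumlz; apply: eq_bigr => j _.
  by rewrite linearZr linearZl /= tE mulrC.
have k_iso f u : g (k f) (i u) = 0.
  by rewrite linear_sumlz big1 // => j _; rewrite linearZl /= i_iso mulr0.
(* [k f] lies in the isotropic image of [i], so subtracting half of it leaves
   the pairing with that image unchanged and cancels [g (t f) (t f')]. *)
pose s f := t f - 2^-1 *: k f.
have s_lin : linear s.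
  move=> a f f'; rewrite /s t_lin k_lin !scalerDr !scalerN !scalerA.
  by rewrite (mulrC a) opprD addrACA.
exists (linfun s); split=> [f u | f f']; rewrite !linear_lfunE // /s.
  by rewrite linearBl /= linearZl /= tE k_iso mulr0 subr0.
have kk : g (k f) (k f') = 0.
  by rewrite {2}/k linear_sumr big1 // => j _; rewrite linearZr /= k_iso mulr0.
rewrite linearBl /= !linearBr /= !linearZl /= !linearZr /= kk kE.
rewrite (symmetric_formC g (k f)) kE (symmetric_formC g (t f')).
by field.
Qed.

End IsotropicSection.

(** * Ad-invariant metrics *)

Section MetricLieAlgebra.
Variables (F : fieldType) (L : lieAlgType F) (g : {symmetric L}).
Hypotheses (g_nd : nondegenerate g) (g_ad : ad_invariant g).

Lemma ad_invariantE x y z : g (lie x y) z = g x (lie y z).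
Proof.
have /eqP := g_ad y x z; rewrite addrC addr_eq0 => /eqP->.
by rewrite lieC linearNl.
Qed.

(** Both inclusions come from [g (lie x y) z = g x (lie y z)]; the one into the centre also uses
    nondegeneracy. *)
Lemma center_orthov : center L = orthov g (commutator L).
Proof.
apply/vspaceP => x; apply/centerP/mem_orthovP => [x0 c Cc | x0 y].
  (* Orthogonality to the commutator becomes inclusion in a kernel, which can be tested on
     brackets. *)
  pose gx := linfun (g x : L -> F^o).
  have gxE y : gx y = g x y by rewrite linear_lfunE //; apply: form_linear.
  suff /subvP/(_ c Cc) : (commutator L <= lker gx)%VS.
    by rewrite memv_ker gxE => /eqP.
  apply/lie_prodvP => y z _ _; rewrite memv_ker gxE.
  by rewrite -ad_invariantE x0 linear0l.
apply: (nondegenerateP _ g_nd) => z.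
by rewrite ad_invariantE x0 // mem_lie_prodv ?memvf.
Qed.

End MetricLieAlgebra.

(** * The decomposition of the metric Lie algebra *)

Theorem theorem3p2 (R : realType) (n : lieAlgType R) (g : {symmetric n}) (m : nat) :
  nondegenerate g -> ad_invariant g ->
  two_step_nilpotent n -> corank n = m ->
  exists (b : {symmetric abelian_lie R m})
         (ip : {dot dual (subvs_of (commutator n)) for idfun})
         (rho : so_map ip),
    nondegenerate b /\
    isomorphic_isometric g (prod_metric b (mcot_metric rho)).
Proof.
move=> g_nd g_ad n_nil corank_n; have sCZ := commutator_center n_nil.
have Z_orthov := center_orthov g_nd g_ad.
have gC : forall x y, g x y = g y x by exact: symmetric_formC.
pose C := commutator n; pose U := subvs_of C.
pose i : 'Hom(U, n) := linfun vsval.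
have iE u : i u = vsval u by rewrite lfunE.
have gZC z c : z \in center n -> c \in C -> g z c = 0.
  by rewrite Z_orthov => /mem_orthovP; apply.
have gCC c c' : c \in C -> c' \in C -> g c c' = 0.
  by move=> /(subvP sCZ) Zc; apply: gZC.
have [||s [sE s_iso]] := isotropic_section (i := i) g_nd.
- by move=> u v; rewrite !iE; apply: val_inj.
- by move=> u v; rewrite !iE gCC ?subvsP.
pose p x : dual U := linfun (fun u => g x (i u) : R^o).
have pE x u : p x u = g x (i u).
  by rewrite linear_lfunE // => a y z; rewrite linearP linearPr.
have p_lin : linear p.
  move=> a x y; apply/lfunP => u.
  by rewrite add_lfunE scale_lfunE !pE linearPl.
have sK f : p (s f) = f by apply/lfunP => u; rewrite pE sE.
have pZ x : (p x == 0) = (x \in center n).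
  rewrite Z_orthov; apply/eqP/mem_orthovP => [px0 c Cc | x0].
    by have := pE x (Subvs Cc); rewrite px0 iE lfunE.
  by apply/lfunP => u; rewrite pE iE x0 ?subvsP ?lfunE.
have pB x y : p (x - y) = p x - p y.
  by rewrite -!(linear_lfunE p_lin) linearB.
have sp x : x - s (p x) \in center n by rewrite -pZ pB sK subrr.
(* Central corrections do not affect brackets, so the bracket depends only on the components [p x]
   and [p y]. *)
have lie_sp x y : lie (s (p x)) (s (p y)) = lie x y.
  have /centerP/(_ (s (p y)))/eqP := sp x.
  have /centerP/(_ x)/eqP := sp y.
  rewrite linearBl /= subr_eq0 => /eqP yx; rewrite linearBl /= subr_eq0 => /eqP <-.
  by rewrite lieC -yx -lieC.
pose T u v w := g (lie (s u) (s v)) (s w).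
pose ip : {dot dual U for idfun} := @coord_dot R (dual U).
have [||||rho rhoE] := @so_map_of_alternating _ _ ip T.
- by move=> v w k u u'; rewrite /T linearP 2!linearPl.
- by move=> u v w; rewrite /T lieC linearNl.
- by move=> u v w; rewrite /T (ad_invariantE g_ad) gC (lieC (s v)) linearNl.
- move=> w w0; apply/eqP; rewrite -[w]sK pZ Z_orthov.
  apply/mem_orthovP => c Cc; rewrite gC.
  pose gw := linfun (g (s w) : n -> R^o).
  have gwE y : gw y = g (s w) y by rewrite linear_lfunE //; apply: form_linear.
  suff /subvP/(_ c Cc) : (commutator n <= lker gw)%VS.
    by rewrite memv_ker gwE gC => /eqP.
  apply/lie_prodvP => x y _ _; rewrite memv_ker gwE gC -lie_sp.
  by apply/eqP; apply: w0.
(* A complement of [C] in the centre stands in for the quotient; its dimension is the corank. *)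
pose A := (center n :\: C)%VS.
have AC0 : (A :&: C = 0)%VS by apply: capv_diff.
have ACZ : (A + C = center n)%VS by rewrite addv_diff; apply/addv_idPl.
have dimA : \dim A = m.
  by rewrite -corank_n /corank -ACZ dimv_disjoint_sum // addnK.
have [a [b bK]] : exists (a : 'Hom(abelian_lie R m, n)) (b : 'Hom(n, abelian_lie R m)),
  {in A, cancel b a} by apply: vspace_coordinates dimA.
pose q x := daddv_pi A C (x - s (p x)).
(* The [C]-components drop out because [C] is orthogonal to the whole centre. *)
have gq x y : g (q x) (q y) = g (x - s (p x)) (y - s (p y)).
  have zE z : z \in center n -> daddv_pi A C z + daddv_pi C A z = z.
    by rewrite -ACZ; apply: daddv_pi_add.
  have AZ z : daddv_pi A C z \in center n.
    by apply: subvP (memv_pi A C z); apply: diffvSl.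
  rewrite -[in RHS](zE _ (sp x)) -[in RHS](zE _ (sp y)).
  have gAC u c : c \in C -> g (daddv_pi A C u) c = 0 by apply/gZC/AZ.
  rewrite linearDl !linearDr /= (gAC _ _ (memv_pi C A _)) addr0.
  rewrite (gC (daddv_pi C A _)) (gAC _ _ (memv_pi C A _)) add0r.
  by rewrite (gCC _ _ (memv_pi C A _) (memv_pi C A _)) addr0.
have q_lin : linear q.
  move=> k x y; rewrite /q p_lin -linearP; congr (daddv_pi A C _).
  by rewrite linearP scalerBr opprD addrACA.
pose ev x : dual (dual U) := linfun (fun f => g x (s f) : R^o).
have evE x f : ev x f = g x (s f).
  by rewrite linear_lfunE // => k y z; rewrite linearP linearPr.
have ev_lin : linear ev.
  move=> k x y; apply/lfunP => f.
  by rewrite add_lfunE scale_lfunE !evE linearPl.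
pose f x : (abelian_lie R m * modified_cotangent rho)%type :=
  (b (q x), (ev x, p x)).
have f_lin : linear f.
  by move=> k x y; rewrite /f q_lin ev_lin p_lin linearP.
pose fl : {linear n -> (abelian_lie R m * modified_cotangent rho)%type} :=
  HB.pack f (GRing.isLinear.Build _ _ _ _ f f_lin).
have f_iso : isometry (prod_metric (pullback_form g a) (mcot_metric rho)) g fl.
  move=> x y.
  (* As [s] is isotropic, expanding [g (x - s (p x)) (y - s (p y))] gives [g x y] minus the two [ev]
     terms, which the hyperbolic part restores. *)
  transitivity (g (a (b (q x))) (a (b (q y))) + (ev x (p y) + ev y (p x))) => //.
  rewrite !bK ?memv_pi // gq !evE linearBl !linearBr /= s_iso (gC y).
  by ring.
have f_inj : injective fl.
  move=> x y fxy; apply/eqP; rewrite -subr_eq0; apply/eqP.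
  apply: (nondegenerateP _ g_nd) => z.
  by rewrite linearBl /= -!f_iso fxy subrr.
have f_bij : bijective fl.
  have lE := linear_lfunE f_lin.
  have : bijective (linfun f).
    apply: inj_lfun_bij; first by move=> x y; rewrite !lE; apply: f_inj.
    rewrite [RHS]dimvf.
    (* The dimensions of the row vectors, the bidual and the dual, as they compute. On the other
       side, [p] maps onto the dual of [C] with kernel the centre. *)
    transitivity (1 * m + (\dim C * 1 * 1 + \dim C * 1))%N => //.
    rewrite !muln1 mul1n.
    have -> : \dim {:n} = (\dim (center n) + \dim C)%N.
      have kp : lker (linfun p) = center n.
        by apply/vspaceP => x; rewrite memv_ker (linear_lfunE p_lin) pZ.
      have ip_full : limg (linfun p) = fullv.
        apply/vspaceP => d; rewrite memvf -[d]sK -(linear_lfunE p_lin).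
        by rewrite memv_img ?memvf.
      have := limg_ker_dim (linfun p) fullv.
      by rewrite kp ip_full capfv [X in (_ + X)%N]dimvf => <-; congr (_ + _)%N; apply: muln1 (\dim C).
    by rewrite -ACZ dimv_disjoint_sum // dimA addnA.
  by move=> lf_bij; apply: eq_bij lf_bij _ lE.
exists (pullback_form g a), ip, rho; split.
  (* A radical vector [r] on the abelian factor gives [(r, 0)] orthogonal to everything; its
     preimage lies in the radical of [g], so it is zero. *)
  apply/nondegenerateP => r r0; have [h _ hK] := f_bij.
  pose y : (abelian_lie R m * modified_cotangent rho)%type := (r, 0).
  suff hy0 : h y = 0 by have := hK y; rewrite hy0 linear0 => -[].
  apply: (nondegenerateP _ g_nd) => z; rewrite -f_iso hK.
  transitivity (pullback_form g a r (b (q z)) + ((0 : dual (dual U)) (p z) + ev z 0)) => //.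
  by rewrite r0 lfunE linear0 !addr0.
exists fl; split=> // x y.
(* Since a bracket lies in [C], its [p] and [q] components vanish; its [ev] component is
   [T (p x) (p y)], the form defining [rho]. *)
have Cxy : lie x y \in C by rewrite mem_lie_prodv ?memvf.
have pxy : p (lie x y) = 0 by apply/eqP; rewrite pZ (subvP sCZ).
have s0 : s 0 = 0 by rewrite linear0.
have qxy : q (lie x y) = 0.
  rewrite /q pxy s0 subr0.
  have := daddv_pi_add AC0 (subvP (addvSr A C) _ Cxy).
  rewrite [daddv_pi C A _]daddv_pi_id ?(capvC C) // => /eqP.
  by rewrite -subr_eq0 addrK => /eqP.
suff evxy : ev (lie x y) = linfun (mcot_pairing rho (p x) (p y)).
  by rewrite /= /f evxy pxy qxy linear0.
by apply/lfunP => d; rewrite evE lfunE /= /mcot_pairing rhoE /T lie_sp.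
Qed.
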